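(* Let $n\geq 3$ and let $P,Q$ be polynomials in two variables over $K$. For $1\leq i\leq n-1$ put $\pi_i f=\partial_i\big(P(x_i,x_{i+1})f\big)+Q(x_i,x_{i+1})\partial_i f$ (the same $P$ and $Q$ for all $i$), and assume that these operators are non-degenerate and that the braid relations hold for $\{\pi_i\}_{i=1}^{n-1}$. Then there are five constants $a,b,c,d,e$ such that $a,b,c,d$ are not all zero and satisfy $ad-bc=0$, and such that for every $1\leq i\leq n-1$ and every $f$ we have $$\pi_i f=(b-c-e)\,\partial_i(x_i f)+\big[a x_i x_{i+1}+(c+e)x_i+c x_{i+1}+d\big]\partial_i f.$$
   Context: $K$ is a field of arbitrary characteristic over which all polynomials are defined; possible extra parameters are regarded as elements of $K$, so ''constant'' means an element of $K$. The operators act on functions $f$ of variables $x_1,\dots,x_n$ (concretely $f\in K[x_1,\dots,x_n]$). The operator $s_i$ interchanges $x_i$ and $x_{i+1}$, and $\partial_i f=\frac{f-s_i f}{x_i-x_{i+1}}$. The braid relations for $\{\pi_i\}_{i=1}^{n-1}$ are $\pi_i\pi_k=\pi_k\pi_i$ for $|k-i|\geq 2$ and $\pi_i\pi_{i+1}\pi_i=\pi_{i+1}\pi_i\pi_{i+1}$ for $1\leq i\leq n-2$. Non-degenerate means that neither of the polynomials $Q_0(u,v)=P(v,u)+Q(u,v)$ and $T(u,v)=P(u,v)+Q(u,v)$ is zero. *)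

(* Defs.v *)
From mathcomp Require Import all_boot all_order all_fingroup all_algebra.
From mathcomp Require Import mpoly.

Set Implicit Arguments.
Unset Strict Implicit.
Unset Printing Implicit Defensive.

Import GRing.Theory.

Local Open Scope ring_scope.

(* Operators are indexed by i : 'I_n.-1, counted from 0: operator number i acts
   on the adjacent variables of index i and i.+1. *)
Definition lvar (n : nat) (i : 'I_n.-1) : 'I_n :=
  Ordinal (leq_trans (ltn_ord i) (leq_pred n)).

Lemma rvar_subproof (n : nat) (i : 'I_n.-1) : (i.+1 < n)%N.
Proof. by rewrite -ltn_predRL. Qed.

Definition rvar (n : nat) (i : 'I_n.-1) : 'I_n := Ordinal (rvar_subproof i).

Section Operators.

Variables (K : fieldType) (n : nat).
Implicit Types (i : 'I_n.-1) (f : {mpoly K[n]}).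

Definition xl i : {mpoly K[n]} := 'X_(lvar i).
Definition xr i : {mpoly K[n]} := 'X_(rvar i).

Definition sop i f : {mpoly K[n]} := msym (tperm (lvar i) (rvar i)) f.

Lemma ddiff_exists i f :
  exists g : {mpoly K[n]}, (xl i - xr i) * g == f - sop i f.
Proof.
rewrite /sop; set s := tperm _ _.
have hM (p q : {mpoly K[n]}) :
    (exists g, (xl i - xr i) * g == p - msym s p) ->
    (exists g, (xl i - xr i) * g == q - msym s q) ->
    exists g, (xl i - xr i) * g == p * q - msym s (p * q).
  move=> [g /eqP hg] [h /eqP hh]; exists (g * q + msym s p * h).
  by rewrite mulrDr mulrA hg mulrCA hh msymM mulrBl mulrBr addrA subrK.
have h1 : exists g, (xl i - xr i) * g == 1 - msym s 1.
  by exists 0; rewrite mulr0 msym1 subrr.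
have hX (k : 'I_n) : exists g, (xl i - xr i) * g == 'X_k - msym s 'X_k.
  have -> : msym s 'X_k = 'X_(s k) :> {mpoly K[n]}.
    rewrite msymX; congr 'X_[_]; apply/mnmP => j.
    by rewrite mnmE !mnm1E -(inj_eq (@perm_inj _ s)) permKV.
  rewrite /s; case: tpermP => [->|->|_ _].
  - by exists 1; rewrite mulr1.
  - by exists (-1); rewrite mulrN1 opprB.
  - by exists 0; rewrite mulr0 subrr.
elim/mpolyind: f => [|c m p _ _ [g /eqP hg]].
  by exists 0; rewrite mulr0 msym0 subr0.
have [h /eqP hh] : exists g, (xl i - xr i) * g == 'X_[m] - msym s 'X_[m].
  rewrite mpolyXE_id; elim/big_ind: _ => // k _.
  by elim: (m k) => [|e IHe]; rewrite ?expr0 // exprS; apply: hM.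
exists (c *: h + g).
by rewrite mulrDr -scalerAr hh hg msymD msymZ scalerBr opprD addrACA.
Qed.

(* The exact quotient (f - s_i f) / (x_i - x_{i+1}); it is unique because
   {mpoly K[n]} is an integral domain, see ddiff_unique. *)
Definition ddiff i f : {mpoly K[n]} := xchoose (ddiff_exists i f).

Lemma ddiffE i f : (xl i - xr i) * ddiff i f = f - sop i f.
Proof. exact/eqP/(xchooseP (ddiff_exists i f)). Qed.

Lemma xlr_neq0 i : xl i - xr i != 0.
Proof.
apply/eqP => /(congr1 (mcoeff U_(lvar i)%MM)) /eqP.
rewrite mcoeffB mcoeff0 !mcoeffXU eqxx -val_eqE /=.
by rewrite (gtn_eqF (ltnSn i)) subr0 oner_eq0.
Qed.

Lemma ddiff_unique i f g : (xl i - xr i) * g = f - sop i f -> g = ddiff i f.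
Proof. by move=> hg; apply: (mulfI (xlr_neq0 i)); rewrite hg ddiffE. Qed.

Implicit Types P Q : {mpoly K[2]}.

Definition at_pair P i : {mpoly K[n]} := P \mPo [tuple xl i; xr i].

Definition piop P Q i f : {mpoly K[n]} :=
  ddiff i (at_pair P i * f) + at_pair Q i * ddiff i f.

End Operators.

(* The variables u, v of K[u, v] are 'X_0 and 'X_1 in {mpoly K[2]}. *)
Definition swap_vars (K : fieldType) (P : {mpoly K[2]}) : {mpoly K[2]} :=
  P \mPo [tuple 'X_1; 'X_0].

Definition pi_nondegenerate (K : fieldType) (P Q : {mpoly K[2]}) : Prop :=
  swap_vars P + Q != 0 /\ P + Q != 0.

Definition braid_relations (n : nat) (E : Type) (p : 'I_n.-1 -> E -> E) : Prop :=
  (forall i k : 'I_n.-1, (i.+2 <= k)%N || (k.+2 <= i)%N ->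
     forall f, p i (p k f) = p k (p i f)) /\
  (forall i j : 'I_n.-1, nat_of_ord j = i.+1 ->
     forall f, p i (p j (p i f)) = p j (p i (p j f))).

(* Main.v *)
(** With T = P + Q and Q0 = P(v,u) + Q(u,v), the operator pi_i is
    f |-> (T f - Q0 s_i f) / (x_i - x_{i+1}).  Expanding both sides of the braid
    relation and comparing the coefficients of 1, s_1, s_2 (ring morphisms are
    linearly independent) gives, with T12 = T(x_1, x_2) and so on,

      T12 T23 (x1 - x3) = T13 T21 (x2 - x3) + T23 T13 (x1 - x2),

    the same relation for T(v,u), and one relation involving Q0.  If T has
    degree k in v, the last product above has degree 2k in x3 and the other two
    have degree at most k + 1, so k <= 1.  Hence T = a uv + b u + c v + d, and
    the relation becomes ad = bc.  Finally Q0 = T - (u - v) W with W symmetric,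
    and the relation for Q0 says that F = W (b - c - W) satisfies
    F(x1, x2) = F(x2, x3); so F, and therefore W, is constant, and
    e = b - c - W. *)
Require Import Defs.
From HB Require Import structures.
From mathcomp Require Import all_boot all_order all_fingroup all_algebra.
From mathcomp Require Import mpoly ring.

Set Implicit Arguments.
Unset Strict Implicit.
Unset Printing Implicit Defensive.

Import GRing.Theory.

Local Open Scope ring_scope.

(** * Linear independence of ring morphisms *)

(** Dedekind's argument, arranged to isolate one coefficient: [phi0] is compared with each entry of
    the list, while entries may coincide with one another, as [s1 s2 s1] and [s2 s1 s2] do in the
    application. *)
Lemma independent_rmorphisms (R : idomainType) (c0 : R)
    (phi0 : {rmorphism R -> R}) (s : seq (R * {rmorphism R -> R})) :
  foldr (fun (t : R * {rmorphism R -> R}) A =>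
    (exists g, (t.2 : {rmorphism R -> R}) g != phi0 g) /\ A) True s ->
  (forall f,
    c0 * phi0 f + \sum_(t <- s) t.1 * (t.2 : {rmorphism R -> R}) f = 0) ->
  c0 = 0.
Proof.
have [m] := ubnP (size s).
elim: m s c0 => // m IHm [|[c1 phi1] s] c0 /= ltsm.
  by move=> _ /(_ 1); rewrite big_nil rmorph1 mulr1 addr0.
move=> [[g hg] hs] rel.
(* Evaluating the relation at g * f and subtracting phi1 g times the relation
   at f eliminates phi1. *)
pose s' := [seq (t.1 * ((t.2 : {rmorphism R -> R}) g - phi1 g), t.2) | t <- s].
have /eqP : c0 * (phi0 g - phi1 g) = 0.
  apply: (IHm s'); rewrite ?size_map //.
    by rewrite /s'; elim: s hs {ltsm rel s'} => //= t s IHs [? /IHs].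
  move=> f; have := rel (g * f); have := rel f.
  rewrite !big_cons big_map /= !rmorphM => rel1 rel2.
  rewrite (eq_bigr (fun t : R * {rmorphism R -> R} =>
      t.1 * (t.2 : {rmorphism R -> R}) (g * f)
      + - (phi1 g * (t.1 * (t.2 : {rmorphism R -> R}) f)))); last first.
    by move=> t _; rewrite rmorphM; ring.
  rewrite big_split sumrN -mulr_sumr /=.
  move: rel1 rel2; set A := bigop.body _ _ _; set B := bigop.body _ _ _.
  move=> /(congr1 ( *%R (phi1 g))); rewrite mulr0 => rel1 rel2.
  rewrite -[RHS](subrr 0) -{2}rel1 -{1}rel2; ring.
by rewrite mulf_eq0 subr_eq0 [phi0 g == _]eq_sym (negbTE hg) orbF => /eqP.
Qed.

(** * Evaluation of two-variable polynomials in commutative rings *)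

Lemma mpoly_rmorph_ext (K : fieldType) (n : nat) (S : comNzRingType)
    (F G : {rmorphism {mpoly K[n]} -> S}) :
  (forall c, F c%:MP = G c%:MP) -> (forall k, F 'X_k = G 'X_k) -> F =1 G.
Proof.
move=> hC hX; elim/mpolyind => [|c m p _ _ IHp]; first by rewrite !rmorph0.
rewrite !rmorphD IHp -mul_mpolyC !rmorphM hC mpolyXE_id !rmorph_prod.
by congr (_ * _ + _); apply: eq_bigr => k _; rewrite !rmorphXn hX.
Qed.

Section EvalPair.

Variables (K : fieldType) (S : comNzRingType) (h : {rmorphism K -> S}).
Implicit Types (T : {mpoly K[2]}) (x y z : S).

(** The target ring is left free, so that substitution into [K[n]], exchange of the variables,
    passage to univariate polynomials and evaluation at constants are one operation. *)
Definition ev_pair x y T : S := mmap h (fun k => if k == 0 then x else y) T.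

Lemma ev_pairC x y c : ev_pair x y c%:MP = h c.
Proof. exact: mmapC. Qed.

Lemma ev_pairX0 x y : ev_pair x y 'X_0 = x.
Proof. by rewrite /ev_pair mmapX mmap1U. Qed.

Lemma ev_pairX1 x y : ev_pair x y 'X_1 = y.
Proof. by rewrite /ev_pair mmapX mmap1U. Qed.

HB.instance Definition _ x y := GRing.RMorphism.copy (ev_pair x y)
  (mmap h (fun k => if k == 0 then x else y)).

(** The universal property of [K[u, v]], from which [rmorph_ev_pair] and [comp_mpoly_pair]
    follow. *)
Lemma ev_pair_unique (F : {rmorphism {mpoly K[2]} -> S}) :
  (forall c, F c%:MP = h c) -> F =1 ev_pair (F 'X_0) (F 'X_1).
Proof.
move=> hC T; apply: mpoly_rmorph_ext T => [c|k].
  by rewrite hC /= [RHS]ev_pairC.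
case: k => [[|[|//]] p] /=.
  have -> : Ordinal p = 0 by exact/val_inj.
  by rewrite [RHS]ev_pairX0.
have -> : Ordinal p = 1 by exact/val_inj.
by rewrite [RHS]ev_pairX1.
Qed.

End EvalPair.

Lemma rmorph_ev_pair (K : fieldType) (S1 S2 : comNzRingType)
    (h1 : {rmorphism K -> S1}) (h2 : {rmorphism K -> S2})
    (F : {rmorphism S1 -> S2}) (x y : S1) (T : {mpoly K[2]}) :
  (forall c, F (h1 c) = h2 c) ->
  F (ev_pair h1 x y T) = ev_pair h2 (F x) (F y) T.
Proof.
move=> hC; apply: etrans (ev_pair_unique (h := h2)
  (F := F \o ev_pair h1 x y) _ T) _ => [c|] /=; first by rewrite ev_pairC hC.
by rewrite ev_pairX0 ev_pairX1.
Qed.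

Lemma comp_mpoly_pair (K : fieldType) (m : nat) (x y : {mpoly K[m]})
    (T : {mpoly K[2]}) :
  T \mPo [tuple x; y] = ev_pair (@mpolyC m K) x y T.
Proof.
apply: etrans (ev_pair_unique (h := @mpolyC m K)
  (F := comp_mpoly [tuple x; y]) _ T) _ => [c|] /=; first exact: comp_mpolyC.
by rewrite !comp_mpolyXU.
Qed.

Lemma ev_pair_swap_vars (K : fieldType) (S : comNzRingType)
    (h : {rmorphism K -> S}) (x y : S) (T : {mpoly K[2]}) :
  ev_pair h x y (swap_vars T) = ev_pair h y x T.
Proof.
rewrite /swap_vars comp_mpoly_pair (rmorph_ev_pair (h2 := h)).
  by rewrite /= ev_pairX0 ev_pairX1.
by move=> c; rewrite /= ev_pairC.
Qed.

Lemma ev_pair_id (K : fieldType) (T : {mpoly K[2]}) :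
  ev_pair (@mpolyC 2 K) 'X_0 'X_1 T = T.
Proof.
by rewrite -[RHS]/(idfun T) [RHS](ev_pair_unique (h := @mpolyC 2 K)).
Qed.

Lemma swap_varsK (K : fieldType) : involutive (@swap_vars K).
Proof.
move=> T; rewrite -[RHS]ev_pair_id -ev_pair_swap_vars.
by rewrite [LHS]comp_mpoly_pair ev_pair_swap_vars.
Qed.

(** * Degree bounds from the three-term relation *)

(** With [k = size t0], the product [t1 * t0] has size [2k - 1] and the other two terms have size at
    most [k + 1]. In the application [t0 = T(x, X)], [t1 = T(y, X)], [u = T(x, y)] and
    [v = T(y, x)]. *)
Lemma size_le2_of_three_term (L : idomainType) (t0 t1 : {poly L})
    (u v x y : L) :
  t0 != 0 -> size t1 = size t0 -> x != y ->
  u%:P * t1 * (x%:P - 'X) = t0 * v%:P * (y%:P - 'X) + t1 * t0 * (x - y)%:P ->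
  (size t0 <= 2)%N.
Proof.
move=> t0_neq0 st neq_xy rel.
have t1_neq0 : t1 != 0 by rewrite -size_poly_eq0 st size_poly_eq0.
have bound z (t : {poly L}) e : size t = size t0 ->
    (size (e%:P * t * (z%:P - 'X))%R <= (size t0).+1)%N.
  move=> <-; apply: leq_trans (size_polyMleq _ _) _.
  rewrite -[z%:P - _]opprB size_polyN size_XsubC addn2 /= ltnS mul_polyC.
  exact: size_scale_leq.
have : (size (t1 * t0 * (x - y)%:P)%R <= (size t0).+1)%N.
  have -> : t1 * t0 * (x - y)%:P =
      u%:P * t1 * (x%:P - 'X) - v%:P * t0 * (y%:P - 'X).
    by rewrite rel [t0 * _]mulrC addrAC subrr add0r.
  apply: leq_trans (size_polyD _ _) _.
  by rewrite geq_max size_polyN !bound.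
rewrite mulrC mul_polyC size_scale ?subr_eq0 // size_mul // st.
by rewrite -subn1 leq_subLR -[(size t0).+1]addn1 addnCA leq_add2l.
Qed.

Section Degree.

Variable K : fieldType.
Implicit Type T : {mpoly K[2]}.


Definition mpair (j k : nat) : 'X_{1..2} := [multinom [tuple j; k]].

Lemma mpair_id (m : 'X_{1..2}) : m = mpair (m 0) (m 1).
Proof.
apply/mnmP => -[[|[|//]] p]; rewrite multinomE (tnth_nth 0%N) /=;
  by congr (m _); exact/val_inj.
Qed.

Lemma mpair_inj j k j' k' : mpair j k = mpair j' k' -> j = j' /\ k = k'.
Proof.
move=> /mnmP e; move: (e 0) (e 1).
by rewrite !multinomE !(tnth_nth 0%N).
Qed.

Lemma mcoeff_swap_vars T j k : (swap_vars T)@_(mpair k j) = T@_(mpair j k).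
Proof.
elim/mpolyind: T => [|c m p _ _ IHp].
  by rewrite [swap_vars 0]comp_mpoly0 !mcoeff0.
rewrite [swap_vars _]comp_mpolyD mcoeffD [RHS]mcoeffD.
congr (_ + _); last exact: IHp.
rewrite comp_mpolyZ !mcoeffZ comp_mpolyX !big_ord_recl big_ord0 mulr1.
rewrite !(tnth_nth 0) /= !mpolyXn -mpolyXD !mcoeffX.
congr (_ * (nat_of_bool _)%:R).
have -> : lift ord0 ord0 = 1 :> 'I_2 by exact/val_inj.
have -> : ord0 = 0 :> 'I_2 by exact/val_inj.
rewrite [X in X == _]mpair_id !mnmDE !mulmnE !mnm1E /=.
rewrite !mul1n !mul0n addn0 add0n.
rewrite {3}[m]mpair_id.
by apply/eqP/eqP => /mpair_inj[-> ->].
Qed.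

Definition polyC_mpolyC : {rmorphism K -> {poly {mpoly K[2]}}} :=
  polyC \o @mpolyC 2 K.

(* T(x, v) as a polynomial in v. *)
Definition as_poly (x : {mpoly K[2]}) T : {poly {mpoly K[2]}} :=
  ev_pair polyC_mpolyC x%:P 'X T.

Lemma as_polyD x : {morph as_poly x : T1 T2 / T1 + T2}.
Proof. exact: raddfD. Qed.

Lemma as_poly0 x : as_poly x 0 = 0.
Proof. exact: raddf0. Qed.

Lemma as_polyZX x c m :
  as_poly x (c *: 'X_[m]) = (c *: x ^+ m 0)%:P * 'X^(m 1).
Proof.
rewrite /as_poly /ev_pair mmapZ mmapX /mmap1 !big_ord_recl big_ord0 mulr1.
rewrite mulrA -[x%:P ^+ _]polyC_exp -[_ * _%:P]polyCM mul_mpolyC.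
by have -> : lift ord0 ord0 = 1 :> 'I_2 by exact/val_inj.
Qed.

(** Turns a bound on the degree in the second variable into the vanishing of coefficients of [T]. *)
Lemma coef_as_poly T j k : (as_poly 'X_0 T)`_k@_(U_(0) *+ j) = T@_(mpair j k).
Proof.
elim/mpolyind: T => [|c m p _ _ IHp]; first by rewrite as_poly0 coef0 !mcoeff0.
rewrite as_polyD coefD mcoeffD [RHS]mcoeffD; congr (_ + _); last exact: IHp.
rewrite as_polyZX coefCM coefXn mulr_natr mcoeffMn !mcoeffZ mcoeffX mcoeffXn.
rewrite -mulrnAr -mulrnA mulnb; congr (_ * (nat_of_bool _)%:R).
apply/andP/eqP => [[/eqP/mnmP/(_ 0) + /eqP ->]|->].
  by rewrite !mulmnE !mnm1E !eqxx !mul1n => <-; apply: mpair_id.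
by rewrite !multinomE !(tnth_nth 0%N) /= !eqxx.
Qed.

Lemma as_poly_neq0 T : T != 0 -> as_poly 'X_0 T != 0.
Proof.
apply: contra_neq => T0; apply/mpolyP => m.
by rewrite [m]mpair_id -coef_as_poly T0 coef0 !mcoeff0.
Qed.

(** One polynomial is the coefficientwise image of the other under the exchange of variables, which
    is injective. *)
Lemma size_as_poly_swap T : size (as_poly 'X_1 T) = size (as_poly 'X_0 T).
Proof.
pose F := comp_mpoly [tuple 'X_1; 'X_0 : {mpoly K[2]}].
have injF : injective F := inv_inj (@swap_varsK K).
have <- : map_poly F (as_poly 'X_0 T) = as_poly 'X_1 T.
  apply: etrans (rmorph_ev_pair (h2 := polyC_mpolyC) (F := map_poly F) _ _ _ _)
    _ => [c|].
    by rewrite /= map_polyC /= /F comp_mpolyC.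
  by rewrite /= map_polyX map_polyC /= /F comp_mpolyXU.
exact: (size_map_inj_poly injF (comp_mpoly0 _)).
Qed.

(** Stated over any commutative [K]-algebra, so that [z] can be the indeterminate of [{poly {mpoly
    K[2]}}] when degrees are compared. *)
Definition three_term (S : comNzRingType) (h : {rmorphism K -> S}) T
    (x y z : S) :=
  ev_pair h x y T * ev_pair h y z T * (x - z)
  = ev_pair h x z T * ev_pair h y x T * (y - z)
    + ev_pair h y z T * ev_pair h x z T * (x - y).

Lemma three_term_size T :
  three_term polyC_mpolyC T ('X_0)%:P ('X_1)%:P 'X -> T != 0 ->
  (size (as_poly 'X_0%R T) <= 2)%N.
Proof.
rewrite /three_term -!/(as_poly _ _).
pose c x y := ev_pair (@mpolyC 2 K) x y T.
have evC x y : ev_pair polyC_mpolyC x%:P y%:P T = (c x y)%:P.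
  by rewrite /c (rmorph_ev_pair (h2 := polyC_mpolyC)).
rewrite !evC -polyCB => rel Tneq0.
apply: (size_le2_of_three_term _ (size_as_poly_swap T) _ rel).
  exact: as_poly_neq0.
rewrite -subr_eq0; apply/eqP => /(congr1 (mcoeff U_(0%R)%MM))/eqP.
by rewrite mcoeffB mcoeff0 !mcoeffXU eqxx subr0 oner_eq0.
Qed.

(** The relation for [T] bounds its degree in [v], the one for [swap_vars T] its degree in [u]; four
    coefficients remain. *)
Lemma three_term_bilinear T :
  T != 0 ->
  (forall (S : comNzRingType) (h : {rmorphism K -> S}) x y z,
    three_term h T x y z) ->
  (forall (S : comNzRingType) (h : {rmorphism K -> S}) x y z,
    three_term h (swap_vars T) x y z) ->
  exists a b c d, T = a *: ('X_0 * 'X_1) + b *: 'X_0 + c *: 'X_1 + d%:MP.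
Proof.
move=> Tneq0 rel rel'.
have degy j k : (1 < k)%N -> T@_(mpair j k) = 0.
  move=> k1; rewrite -coef_as_poly nth_default ?mcoeff0 //.
  exact: leq_trans (three_term_size (rel _ _ _ _ _) Tneq0) k1.
have degx j k : (1 < j)%N -> T@_(mpair j k) = 0.
  move=> j1; rewrite -mcoeff_swap_vars -coef_as_poly nth_default ?mcoeff0 //.
  apply: leq_trans (three_term_size (rel' _ _ _ _ _) _) j1.
  by apply: contra_neq Tneq0 => T0; rewrite -[T]swap_varsK T0 [LHS]comp_mpoly0.
exists T@_(mpair 1 1), T@_(mpair 1 0), T@_(mpair 0 1), T@_(mpair 0 0).
apply/mpolyP => m; rewrite [m]mpair_id; move: (m 0) (m 1) => j k {m}.
rewrite !mcoeffD !mcoeffZ mcoeffC -mpolyXD !mcoeffX.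
have -> : (U_(0%R) + U_(1%R))%MM = mpair 1 1.
  by rewrite [LHS]mpair_id !mnmDE !mnm1E.
have -> : U_(0%R)%MM = mpair 1 0 by rewrite [LHS]mpair_id !mnm1E.
have -> : U_(1%R)%MM = mpair 0 1 by rewrite [LHS]mpair_id !mnm1E.
have -> : 0%MM = mpair 0 0 by rewrite [LHS]mpair_id !mnm0E.
have mpairE j1 k1 j2 k2 :
    (mpair j1 k1 == mpair j2 k2) = (j1 == j2) && (k1 == k2).
  by apply/eqP/andP => [/mpair_inj[-> ->]|[/eqP-> /eqP->]].
rewrite !mpairE; case: j => [|[|j]]; last by rewrite degx //= !mulr0 !addr0.
all: case: k => [|[|k]]; last by rewrite degy //= !mulr0 !addr0.
all: by rewrite /= ?(mulr0, mulr1, addr0, add0r).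
Qed.

End Degree.

(** * The braid relation over a domain with two abstract involutions *)

Section Braid.

Variables (R : idomainType) (s1 s2 : {rmorphism R -> R}) (x1 x2 x3 : R).
Variables (t q : R -> R -> R) (p1 p2 : R -> R).

Hypotheses (neq12 : x1 != x2) (neq13 : x1 != x3) (neq23 : x2 != x3).
Hypotheses (s1x1 : s1 x1 = x2) (s1x2 : s1 x2 = x1) (s1x3 : s1 x3 = x3).
Hypotheses (s2x1 : s2 x1 = x1) (s2x2 : s2 x2 = x3) (s2x3 : s2 x3 = x2).
Hypotheses (s1K : involutive s1) (s2K : involutive s2).
Hypotheses (s1t : forall x y, s1 (t x y) = t (s1 x) (s1 y))
  (s1q : forall x y, s1 (q x y) = q (s1 x) (s1 y))
  (s2t : forall x y, s2 (t x y) = t (s2 x) (s2 y))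
  (s2q : forall x y, s2 (q x y) = q (s2 x) (s2 y)).
Hypotheses
  (p1E : forall f, (x1 - x2) * p1 f = t x1 x2 * f - q x1 x2 * s1 f)
  (p2E : forall f, (x2 - x3) * p2 f = t x2 x3 * f - q x2 x3 * s2 f).

(** The factor on the left is the common denominator: [p1] acts twice, and the permutations turn the
    differences of variables into one another up to sign. *)
Lemma word121 f :
  (x1 - x2) ^+ 2 * (x2 - x3) * (x1 - x3) * p1 (p2 (p1 f)) =
  (x1 - x3) * t x1 x2 * t x2 x3 * (t x1 x2 * f - q x1 x2 * s1 f)
  - (x1 - x2) * t x1 x2 * q x2 x3 * (t x1 x3 * s2 f - q x1 x3 * s2 (s1 f))
  + (x2 - x3) * q x1 x2 * t x1 x3 * (t x2 x1 * s1 f - q x2 x1 * f)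
  + (x1 - x2) * q x1 x2 * q x1 x3
    * (t x2 x3 * s1 (s2 f) - q x2 x3 * s1 (s2 (s1 f))).
Proof.
(* The images of [p1E f] under [s1], [s2] and [s1 s2] carry the denominators [x2 - x1], [x1 - x3]
   and [x2 - x3]. *)
have e0 := p1E f; have e1 := congr1 s1 e0; have e2 := congr1 s2 e0.
have e12 := congr1 s1 e2; have h0 := p2E (p1 f); have h1 := congr1 s1 h0.
rewrite !rmorphM !rmorphB !rmorphM s1t s1q s1K s1x1 s1x2 in e1.
rewrite !rmorphM !rmorphB !rmorphM s2t s2q s2x1 s2x2 in e2.
rewrite !rmorphM !rmorphB !rmorphM s2t s2q !(s1t, s1q) s2x1 s2x2 s1x1 s1x3
  in e12.
rewrite !rmorphM !rmorphB !rmorphM s1t s1q s1x2 s1x3 in h1.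
transitivity ((x1 - x2) * (x2 - x3) * (x1 - x3)
  * ((x1 - x2) * p1 (p2 (p1 f)))).
  by ring.
rewrite p1E.
transitivity ((x1 - x2) * (x1 - x3) * t x1 x2 * ((x2 - x3) * p2 (p1 f))
  - (x1 - x2) * (x2 - x3) * q x1 x2 * ((x1 - x3) * s1 (p2 (p1 f)))).
  by ring.
rewrite h0 h1.
transitivity ((x1 - x3) * t x1 x2 * t x2 x3 * ((x1 - x2) * p1 f)
  - (x1 - x2) * t x1 x2 * q x2 x3 * ((x1 - x3) * s2 (p1 f))
  + (x2 - x3) * q x1 x2 * t x1 x3 * ((x2 - x1) * s1 (p1 f))
  + (x1 - x2) * q x1 x2 * q x1 x3 * ((x2 - x3) * s1 (s2 (p1 f)))).
  by ring.
by rewrite e0 e1 e2 e12.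
Qed.

Lemma word212 f :
  (x2 - x3) ^+ 2 * (x1 - x2) * (x1 - x3) * p2 (p1 (p2 f)) =
  (x1 - x3) * t x2 x3 * t x1 x2 * (t x2 x3 * f - q x2 x3 * s2 f)
  - (x2 - x3) * t x2 x3 * q x1 x2 * (t x1 x3 * s1 f - q x1 x3 * s1 (s2 f))
  + (x1 - x2) * q x2 x3 * t x1 x3 * (t x3 x2 * s2 f - q x3 x2 * f)
  + (x2 - x3) * q x2 x3 * q x1 x3
    * (t x1 x2 * s2 (s1 f) - q x1 x2 * s2 (s1 (s2 f))).
Proof.
have e0 := p2E f; have e2 := congr1 s2 e0; have e1 := congr1 s1 e0.
have e21 := congr1 s2 e1; have h0 := p1E (p2 f); have h2 := congr1 s2 h0.
rewrite !rmorphM !rmorphB !rmorphM s2t s2q s2K s2x2 s2x3 in e2.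
rewrite !rmorphM !rmorphB !rmorphM s1t s1q s1x2 s1x3 in e1.
rewrite !rmorphM !rmorphB !rmorphM s1t s1q !(s2t, s2q) s1x2 s1x3 s2x1 s2x3
  in e21.
rewrite !rmorphM !rmorphB !rmorphM s2t s2q s2x1 s2x2 in h2.
transitivity ((x1 - x2) * (x2 - x3) * (x1 - x3)
  * ((x2 - x3) * p2 (p1 (p2 f)))).
  by ring.
rewrite p2E.
transitivity ((x2 - x3) * (x1 - x3) * t x2 x3 * ((x1 - x2) * p1 (p2 f))
  - (x1 - x2) * (x2 - x3) * q x2 x3 * ((x1 - x3) * s2 (p1 (p2 f)))).
  by ring.
rewrite h0 h2.
transitivity ((x1 - x3) * t x2 x3 * t x1 x2 * ((x2 - x3) * p2 f)
  - (x2 - x3) * t x2 x3 * q x1 x2 * ((x1 - x3) * s1 (p2 f))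
  + (x1 - x2) * q x2 x3 * t x1 x3 * ((x3 - x2) * s2 (p2 f))
  + (x2 - x3) * q x2 x3 * q x1 x3 * ((x1 - x2) * s2 (s1 (p2 f)))).
  by ring.
by rewrite e0 e1 e2 e21.
Qed.

Hypothesis braid : forall f, p1 (p2 (p1 f)) = p2 (p1 (p2 f)).

(* The coefficients of id, s1, s2, s1 s2 s1 in the difference of the two words,
   multiplied by the common denominator; those of s1 s2 and s2 s1 cancel. *)
Let c0 :=
  (x2 - x3) * ((x1 - x3) * t x1 x2 ^+ 2 * t x2 x3
               - (x2 - x3) * t x1 x3 * (q x1 x2 * q x2 x1))
  - (x1 - x2) * ((x1 - x3) * t x2 x3 ^+ 2 * t x1 x2
                 - (x1 - x2) * t x1 x3 * (q x2 x3 * q x3 x2)).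
Let c1 := (x2 - x3) * q x1 x2 *
  ((x2 - x3) * t x1 x3 * t x2 x1 + (x1 - x2) * t x2 x3 * t x1 x3
   - (x1 - x3) * t x1 x2 * t x2 x3).
Let c2 := (x1 - x2) * q x2 x3 *
  ((x1 - x3) * t x1 x2 * t x2 x3 - (x2 - x3) * t x1 x2 * t x1 x3
   - (x1 - x2) * t x1 x3 * t x3 x2).
Let c121 := - ((x1 - x2) * (x2 - x3) * q x1 x2 * q x1 x3 * q x2 x3).

Lemma braid_relation f :
  c0 * f + c1 * s1 f + c2 * s2 f + c121 * s1 (s2 (s1 f))
  - c121 * s2 (s1 (s2 f)) = 0.
Proof.
(* The two extra factors bring both words to the denominator [(x1 - x2)^2 (x2 - x3)^2 (x1 - x3)]. *)
have := congr1 ( *%R (x1 - x2)) (word212 f).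
have := congr1 ( *%R (x2 - x3)) (word121 f).
rewrite braid => w1 w2.
transitivity (
  (x2 - x3) * ((x1 - x2) ^+ 2 * (x2 - x3) * (x1 - x3) * p2 (p1 (p2 f)))
  - (x1 - x2) * ((x2 - x3) ^+ 2 * (x1 - x2) * (x1 - x3) * p2 (p1 (p2 f))));
  last by ring.
by rewrite w1 w2 /c0 /c1 /c2 /c121; ring.
Qed.

(** Here and in the next two lemmas the morphism of the wanted coefficient is taken as [phi0]; each
    witness is a variable on which it differs from the other morphism. *)
Lemma braid_coef0 : c0 = 0.
Proof.
apply: (independent_rmorphisms (phi0 := idfun)
  (s := [:: (c1, s1); (c2, s2); (c121, s1 \o (s2 \o s1) : {rmorphism R -> R});
            (- c121, s2 \o (s1 \o s2) : {rmorphism R -> R})])) => /=.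
  split; first by exists x1; rewrite s1x1 eq_sym.
  split; first by exists x2; rewrite s2x2 eq_sym.
  split; first by exists x1; rewrite /= s1x1 s2x2 s1x3 eq_sym.
  split=> //; by exists x1; rewrite /= s2x1 s1x1 s2x2 eq_sym.
move=> f; rewrite !big_cons big_nil /= -[RHS](braid_relation f); ring.
Qed.

Lemma braid_coef1 : c1 = 0.
Proof.
apply: (independent_rmorphisms (phi0 := s1)
  (s := [:: (c0, idfun : {rmorphism R -> R}); (c2, s2);
            (c121, s1 \o (s2 \o s1) : {rmorphism R -> R});
            (- c121, s2 \o (s1 \o s2) : {rmorphism R -> R})])) => /=.
  split; first by exists x1; rewrite s1x1.
  split; first by exists x1; rewrite s2x1 s1x1.
  split; first by exists x1; rewrite /= s1x1 s2x2 s1x3 eq_sym.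
  split=> //; by exists x1; rewrite /= s2x1 s1x1 s2x2 eq_sym.
move=> f; rewrite !big_cons big_nil /= -[RHS](braid_relation f); ring.
Qed.

Lemma braid_coef2 : c2 = 0.
Proof.
apply: (independent_rmorphisms (phi0 := s2)
  (s := [:: (c0, idfun : {rmorphism R -> R}); (c1, s1);
            (c121, s1 \o (s2 \o s1) : {rmorphism R -> R});
            (- c121, s2 \o (s1 \o s2) : {rmorphism R -> R})])) => /=.
  split; first by exists x2; rewrite s2x2.
  split; first by exists x1; rewrite s2x1 s1x1 eq_sym.
  split; first by exists x1; rewrite /= s1x1 s2x2 s1x3 s2x1 eq_sym.
  split=> //; by exists x1; rewrite /= s2x1 s1x1 s2x2 eq_sym.
move=> f; rewrite !big_cons big_nil /= -[RHS](braid_relation f); ring.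
Qed.

Hypotheses (q12 : q x1 x2 != 0) (q23 : q x2 x3 != 0).

(** [c1 = 0] with its nonzero factor [(x2 - x3) * q x1 x2] cancelled; the condition on [Q0] enters
    here. *)
Lemma braid_three_term1 :
  t x1 x2 * t x2 x3 * (x1 - x3)
  = t x1 x3 * t x2 x1 * (x2 - x3) + t x2 x3 * t x1 x3 * (x1 - x2).
Proof.
have /eqP := braid_coef1; rewrite /c1.
rewrite !mulf_eq0 subr_eq0 (negbTE neq23) (negbTE q12).
move=> /eqP e; apply/eqP; rewrite -subr_eq0 -oppr_eq0 -[X in _ == X]e.
by apply/eqP; ring.
Qed.

(** Comes from [c2 = 0]; with the variables in reverse order it is the three-term relation of [t]
    with exchanged arguments. *)
Lemma braid_three_term2 :
  t x1 x2 * t x2 x3 * (x1 - x3)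
  = t x1 x2 * t x1 x3 * (x2 - x3) + t x1 x3 * t x3 x2 * (x1 - x2).
Proof.
have /eqP := braid_coef2; rewrite /c2.
rewrite !mulf_eq0 subr_eq0 (negbTE neq12) (negbTE q23).
move=> /eqP e; apply/eqP; rewrite -subr_eq0 -[X in _ == X]e.
by apply/eqP; ring.
Qed.

(** The three-term relations, multiplied by [(x2 - x3) * t x1 x2] and [(x1 - x2) * t x2 x3], replace
    the two terms of [c0] that contain a square of [t]; the products of [t x1 x2], [t x1 x3] and
    [t x2 x3] then cancel. *)
Lemma braid_identity_term :
  t x1 x3 * ((x2 - x3) ^+ 2 * (t x1 x2 * t x2 x1 - q x1 x2 * q x2 x1)
             - (x1 - x2) ^+ 2 * (t x2 x3 * t x3 x2 - q x2 x3 * q x3 x2)) = 0.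
Proof.
have := braid_coef0; rewrite /c0 => e0.
have e1 := congr1 ( *%R ((x2 - x3) * t x1 x2)) braid_three_term1.
have e2 := congr1 ( *%R ((x1 - x2) * t x2 x3)) braid_three_term2.
move/eqP: e1; rewrite -subr_eq0 => /eqP e1.
move/eqP: e2; rewrite -subr_eq0 => /eqP e2.
(* Zero is written as [0 + (0 - 0)], and the three zeros become the left sides of [e0], [e2] and
   [e1]. *)
rewrite -[RHS](addr0 0) -[X in _ = _ + X](subrr 0) -{1}e0 -{1}e2 -e1; ring.
Qed.

End Braid.

(** * The symmetric quotient, constancy criteria and polynomial identities *)

Lemma msymXU (K : fieldType) (n : nat) (s : 'S_n) (k : 'I_n) :
  msym s 'X_k = 'X_(s k) :> {mpoly K[n]}.
Proof.
rewrite msymX; congr 'X_[_]; apply/mnmP => j.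
by rewrite mnmE !mnm1E -(inj_eq (@perm_inj _ s)) permKV.
Qed.

Lemma msymC (K : fieldType) (n : nat) (s : 'S_n) (c : K) :
  msym s c%:MP = c%:MP.
Proof. exact: mmapC. Qed.

Lemma msym_ev_pair (K : fieldType) (n : nat) (s : 'S_n) (x y : {mpoly K[n]})
    (T : {mpoly K[2]}) :
  msym s (ev_pair (@mpolyC n K) x y T) =
  ev_pair (@mpolyC n K) (msym s x) (msym s y) T.
Proof. by rewrite (rmorph_ev_pair (h2 := @mpolyC n K)) //; exact: msymC. Qed.

(** [W] is the divided difference for two variables, symmetric because numerator and denominator
    both change sign under the exchange. It measures [T - Q0 = (u - v) W]. *)
Lemma symmetric_quotient (K : fieldType) (P : {mpoly K[2]}) :
  exists W, ('X_0 - 'X_1) * W = P - swap_vars P /\ swap_vars W = W.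
Proof.
pose i : 'I_2.-1 := ord0; exists (ddiff i P).
have xlE : xl K i = 'X_0 by congr 'X_(_); exact/val_inj.
have xrE : xr K i = 'X_1 by congr 'X_(_); exact/val_inj.
have sopE : sop i P = swap_vars P.
  rewrite /swap_vars comp_mpoly_pair /sop -[X in msym _ X]ev_pair_id.
  rewrite msym_ev_pair.
  rewrite -{1}xlE -{1}xrE /xl /xr !msymXU tpermL tpermR.
  by rewrite -/(xl K i) -/(xr K i) xlE xrE.
have WE : ('X_0 - 'X_1) * ddiff i P = P - swap_vars P.
  by rewrite -xlE -xrE ddiffE sopE.
split=> //; apply: (mulfI (xlr_neq0 K i)); rewrite xlE xrE WE.
have swapW : swap_vars (('X_0 - 'X_1) * ddiff i P)
    = ('X_1 - 'X_0) * swap_vars (ddiff i P).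
  by rewrite /swap_vars rmorphM rmorphB /= !comp_mpolyXU.
have swapP : swap_vars (P - swap_vars P) = swap_vars P - P.
  by rewrite [LHS]comp_mpolyB; congr (_ - _); apply: swap_varsK.
by rewrite -[LHS]opprK -mulNr opprB -swapW WE swapP opprB.
Qed.

(** Degrees add in a domain: if neither factor vanishes, both have degree zero. *)
Lemma mpoly_const_of_quadratic (K : fieldType) (n : nat) (W : {mpoly K[n]})
    (b c : K) :
  W * (b%:MP - W) = c%:MP -> exists w, W = w%:MP.
Proof.
move=> e; have [V0|V_neq0] := eqVneq (b%:MP - W) 0.
  by exists b; apply/eqP; rewrite eq_sym -subr_eq0 V0.
have [->|W_neq0] := eqVneq W 0; first by exists 0.
exists W@_0; apply: msize1_polyC; move: (msizeM W_neq0 V_neq0).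
have : (msize (W * (b%:MP - W))%R <= 1)%N by rewrite e msizeC leq_b1.
move=> + sW; rewrite sW -subn1 leq_subLR.
have : (0 < msize (b%:MP - W)%R)%N by rewrite lt0n msize_poly_eq0.
case: (msize (_ - _)) => // k _; rewrite addnS ltnS; apply: leq_trans.
exact: leq_addr.
Qed.

(** Two shifts suffice: [F(u, v) = F(v, 0) = F(0, 0)]. *)
Lemma mpoly_const_of_ev_pair (K : fieldType) (F : {mpoly K[2]}) :
  (forall (S : comNzRingType) (h : {rmorphism K -> S}) x y z,
    ev_pair h x y F = ev_pair h y z F) ->
  exists c, F = c%:MP.
Proof.
move=> eF; exists (ev_pair (idfun : {rmorphism K -> K}) 0 0 F).
rewrite (rmorph_ev_pair (h2 := @mpolyC 2 K)) //= mpolyC0.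
by rewrite -(eF _ _ 'X_1) -(eF _ _ 'X_0) ev_pair_id.
Qed.

Lemma ev_pair_bilinear (K : fieldType) (S : comNzRingType)
    (h : {rmorphism K -> S}) (x y : S) (a b c d : K) :
  ev_pair h x y (a *: ('X_0 * 'X_1) + b *: 'X_0 + c *: 'X_1 + d%:MP)
  = h a * (x * y) + h b * x + h c * y + h d.
Proof.
rewrite !rmorphD -!mul_mpolyC !rmorphM /= !ev_pairC.
by rewrite ev_pairX0 ev_pairX1.
Qed.

(** In use, [sf] is [s_i f], and [g], [g'] are the divided differences of [x f] and [f]. *)
Lemma normal_form_identity (R : comNzRingType) (x y a b c d w f sf g g' : R) :
  (x - y) * g = x * f - y * sf -> (x - y) * g' = f - sf ->
  (a * (x * y) + b * x + c * y + d) * f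
    - (a * (x * y) + b * x + c * y + d - (x - y) * w) * sf
  = (x - y) * (w * g + (a * (x * y) + (b - w) * x + c * y + d) * g').
Proof.
move=> eg eg'.
rewrite [RHS]mulrDr [X in _ = X + _]mulrCA [X in _ = _ + X]mulrCA eg eg'; ring.
Qed.

Lemma mulrDBl_regroup (R : comNzRingType) (p p' q f sf : R) :
  p * f - p' * sf + q * (f - sf) = (p + q) * f - (p' + q) * sf.
Proof. ring. Qed.

Lemma rmorph_three_term (R S : comNzRingType) (F : {rmorphism R -> S})
    (p1 p2 p3 p4 p5 p6 x y z : R) (q1 q2 q3 q4 q5 q6 x' y' z' : S) :
  p1 * p2 * (x - z) = p3 * p4 * (y - z) + p5 * p6 * (x - y) ->
  F p1 = q1 -> F p2 = q2 -> F p3 = q3 -> F p4 = q4 -> F p5 = q5 -> F p6 = q6 ->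
  F x = x' -> F y = y' -> F z = z' ->
  q1 * q2 * (x' - z') = q3 * q4 * (y' - z') + q5 * q6 * (x' - y').
Proof.
move=> /(congr1 F); rewrite rmorphD !rmorphM !rmorphB.
by move=> + <- <- <- <- <- <- <- <- <-.
Qed.

Lemma three_term_reverse (R : comNzRingType) (pzy pyx pzx pxy x y z : R) :
  pzy * pyx * (z - x) = pzy * pzx * (y - x) + pzx * pxy * (z - y) ->
  pyx * pzy * (x - z) = pzx * pxy * (y - z) + pzy * pzx * (x - y).
Proof.
by move=> e; rewrite -[LHS]opprK -mulrN opprB [pyx * _]mulrC e; ring.
Qed.

(** The two sides of the relation differ by exactly [ad - bc] times the Vandermonde product. *)
Lemma bilinear_defect (R : comNzRingType) (a b c d x y z : R) :
  let t x y := a * (x * y) + b * x + c * y + d in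
  t x y * t y z * (x - z) = t x z * t y x * (y - z) + t y z * t x z * (x - y) ->
  (a * d - b * c) * ((x - y) * (y - z) * (x - z)) = 0.
Proof.
move=> /= /eqP; rewrite -subr_eq0 => /eqP e; rewrite -[RHS]e; ring.
Qed.

(** Since [t - t' = (x - y) (b - c)], expanding [q * q'] produces a second factor [x - y]. *)
Lemma bilinear_quadratic (R : comNzRingType) (a b c d w x y t t' q q' : R) :
  t = a * (x * y) + b * x + c * y + d -> t' = a * (y * x) + b * y + c * x + d ->
  q = t - (x - y) * w -> q' = t' - (y - x) * w ->
  t * t' - q * q' = - ((x - y) ^+ 2 * (w * (b - c - w))).
Proof. by move=> -> -> -> ->; ring. Qed.

Lemma quadratic_eq (R : idomainType) (t x y A B u v : R) :
  A = - (x ^+ 2 * u) -> B = - (y ^+ 2 * v) ->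
  t * (y ^+ 2 * A - x ^+ 2 * B) = 0 -> t != 0 -> x != 0 -> y != 0 -> u = v.
Proof.
move=> -> -> + t0 x0 y0.
have -> : t * (y ^+ 2 * - (x ^+ 2 * u) - x ^+ 2 * - (y ^+ 2 * v))
  = t * (x * y) ^+ 2 * (v - u) by ring.
move/eqP; rewrite !mulf_eq0 (negbTE t0) (negbTE x0) (negbTE y0) subr_eq0.
by move/eqP.
Qed.

(** * Transfer to the operators [piop] *)

Section Operators.

Variables (K : fieldType) (n : nat) (P Q : {mpoly K[2]}).

Local Notation ev := (ev_pair (@mpolyC n K)).

Lemma piopE (i : 'I_n.-1) f :
  (xl K i - xr K i) * piop P Q i f
  = ev (xl K i) (xr K i) (P + Q) * f
    - ev (xl K i) (xr K i) (swap_vars P + Q) * sop i f.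
Proof.
rewrite /piop /at_pair !comp_mpoly_pair mulrDr ddiffE mulrCA ddiffE.
rewrite /sop rmorphM /= msym_ev_pair /xl /xr !msymXU tpermL tpermR.
rewrite [ev_pair _ _ _ (P + Q)]rmorphD [ev_pair _ _ _ (_ + Q)]rmorphD /=.
by rewrite ev_pair_swap_vars; exact: mulrDBl_regroup.
Qed.

Lemma eval_three_variables (k1 k2 k3 : 'I_n) (S : comNzRingType)
    (h : {rmorphism K -> S}) (x y z : S) :
  k1 != k2 -> k1 != k3 -> k2 != k3 ->
  exists F : {rmorphism {mpoly K[n]} -> S},
    [/\ F 'X_k1 = x, F 'X_k2 = y, F 'X_k3 = z & forall c, F c%:MP = h c].
Proof.
move=> neq12 neq13 neq23.
exists (mmap h (fun k => if k == k1 then x else if k == k2 then y else z)).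
split=> [||| c] /=; last exact: mmapC.
- by rewrite mmapX mmap1U eqxx.
- by rewrite mmapX mmap1U [k2 == k1]eq_sym (negbTE neq12) eqxx.
- rewrite mmapX mmap1U [k3 == k1]eq_sym (negbTE neq13).
  by rewrite [k3 == k2]eq_sym (negbTE neq23).
Qed.

(** Sending ['X_k1] to [u] and every other variable to [v] is a left inverse of the substitution. *)
Lemma ev_pair_neq0 (k1 k2 : 'I_n) (T : {mpoly K[2]}) :
  k1 != k2 -> T != 0 -> ev 'X_k1 'X_k2 T != 0.
Proof.
move=> neq12; apply: contra_neq => T0.
pose F : {rmorphism {mpoly K[n]} -> {mpoly K[2]}} :=
  mmap (@mpolyC 2 K) (fun k => if k == k1 then 'X_0 else 'X_1).
have := congr1 F T0; rewrite rmorph0 (rmorph_ev_pair (h2 := @mpolyC 2 K)).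
  rewrite /F /= !mmapX !mmap1U eqxx [k2 == k1]eq_sym (negbTE neq12).
  by rewrite ev_pair_id.
by move=> c; exact: mmapC.
Qed.

Lemma lvar_eq_rvar (i j : 'I_n.-1) : nat_of_ord j = i.+1 -> lvar j = rvar i.
Proof. by move=> ij; apply/val_inj. Qed.

Lemma mpolyX_inj (k1 k2 : 'I_n) :
  k1 != k2 -> 'X_k1 != 'X_k2 :> {mpoly K[n]}.
Proof.
move=> neq12; apply/eqP => /(congr1 (mcoeff U_(k1)%MM))/eqP.
by rewrite !mcoeffXU eqxx [k2 == k1]eq_sym (negbTE neq12) oner_eq0.
Qed.

(** [w] is the constant value of [(T - Q0) / (u - v)]; after multiplication by [x_i - x_{i+1}] both
    sides are combinations of [f] and [s_i f]. *)
Lemma piop_normal_form (i : 'I_n.-1) (a b c d w : K) f :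
  P + Q = a *: ('X_0 * 'X_1) + b *: 'X_0 + c *: 'X_1 + d%:MP ->
  P + Q - ('X_0 - 'X_1) * w%:MP = swap_vars P + Q ->
  piop P Q i f =
    w *: ddiff i (xl K i * f)
    + (a *: (xl K i * xr K i) + (b - w) *: xl K i + c *: xr K i
       + d%:MP) * ddiff i f.
Proof.
move=> TE QE; apply: (mulfI (xlr_neq0 K i)); rewrite piopE.
rewrite -{}QE rmorphB rmorphM rmorphB /= ev_pairX0 ev_pairX1 ev_pairC.
rewrite {}TE ev_pair_bilinear -!mul_mpolyC mpolyCB.
apply: normal_form_identity; rewrite ddiffE //.
by rewrite /sop rmorphM /= /xl msymXU tpermL.
Qed.

(** * Consequences of one braid relation between neighbouring operators *)

Hypothesis nondegenerate : pi_nondegenerate P Q.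
Variables i j : 'I_n.-1.
Hypothesis ij : nat_of_ord j = i.+1.
Hypothesis braid : forall f,
  piop P Q i (piop P Q j (piop P Q i f))
  = piop P Q j (piop P Q i (piop P Q j f)).

Let neq12 : lvar i != rvar i.
Proof. by rewrite -val_eqE /= neq_ltn ltnSn. Qed.
Let neq23 : rvar i != rvar j.
Proof. by rewrite -val_eqE /= ij neq_ltn ltnSn. Qed.
Let neq13 : lvar i != rvar j.
Proof. by rewrite -val_eqE /= ij neq_ltn ltnW. Qed.

Local Notation T := (P + Q).
Local Notation Q0 := (swap_vars P + Q).

Let t x y := ev x y T.
Let q x y := ev x y Q0.

Lemma braid_consequences :
  let x1 := xl K i in let x2 := xr K i in let x3 := xr K j in
  [/\ t x1 x2 * t x2 x3 * (x1 - x3)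
      = t x1 x3 * t x2 x1 * (x2 - x3) + t x2 x3 * t x1 x3 * (x1 - x2),
      t x1 x2 * t x2 x3 * (x1 - x3)
      = t x1 x2 * t x1 x3 * (x2 - x3) + t x1 x3 * t x3 x2 * (x1 - x2)
    & t x1 x3 * ((x2 - x3) ^+ 2 * (t x1 x2 * t x2 x1 - q x1 x2 * q x2 x1)
        - (x1 - x2) ^+ 2 * (t x2 x3 * t x3 x2 - q x2 x3 * q x3 x2)) = 0].
Proof.
move=> x1 x2 x3.
(* The two operators share the middle variable, which is what lets [s2] act on [x2] and [x3]. *)
have x2E : x2 = xl K j by rewrite /x2 /xl /xr (lvar_eq_rvar ij).
have [Q0_neq0 T_neq0] := nondegenerate.
pose s1 : {rmorphism {mpoly K[n]} -> {mpoly K[n]}} :=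
  msym (tperm (lvar i) (rvar i)).
pose s2 : {rmorphism {mpoly K[n]} -> {mpoly K[n]}} :=
  msym (tperm (lvar j) (rvar j)).
have n12 : x1 != x2 by exact: mpolyX_inj.
have n13 : x1 != x3 by exact: mpolyX_inj.
have n23 : x2 != x3 by exact: mpolyX_inj.
have s11 : s1 x1 = x2 by rewrite /s1 /= msymXU tpermL.
have s12 : s1 x2 = x1 by rewrite /s1 /= msymXU tpermR.
have s13 : s1 x3 = x3 by rewrite /s1 /= msymXU tpermD.
have s21 : s2 x1 = x1.
  by rewrite /s2 /= msymXU tpermD // ?(lvar_eq_rvar ij) eq_sym.
have s22 : s2 x2 = x3 by rewrite x2E /s2 /= msymXU tpermL.
have s23 : s2 x3 = x2 by rewrite x2E /s2 /= msymXU tpermR.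
have invol k l : involutive (msym (tperm k l) : {mpoly K[n]} -> _).
  by move=> f; rewrite -msymMm tperm2 msym1m.
have ev_s1 U x y : s1 (ev x y U) = ev (s1 x) (s1 y) U by exact: msym_ev_pair.
have ev_s2 U x y : s2 (ev x y U) = ev (s2 x) (s2 y) U by exact: msym_ev_pair.
have p1 f : (x1 - x2) * piop P Q i f = t x1 x2 * f - q x1 x2 * s1 f.
  exact: piopE.
have p2 f : (x2 - x3) * piop P Q j f = t x2 x3 * f - q x2 x3 * s2 f.
  by rewrite x2E; exact: piopE.
have q12 : q x1 x2 != 0 by exact: ev_pair_neq0.
have q23 : q x2 x3 != 0 by exact: ev_pair_neq0.
have s1K : involutive s1 := invol _ _.
have s2K : involutive s2 := invol _ _.
have s1t x y : s1 (t x y) = t (s1 x) (s1 y) by exact: ev_s1.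
have s1q x y : s1 (q x y) = q (s1 x) (s1 y) by exact: ev_s1.
have s2t x y : s2 (t x y) = t (s2 x) (s2 y) by exact: ev_s2.
have s2q x y : s2 (q x y) = q (s2 x) (s2 y) by exact: ev_s2.
have b1 := braid_three_term1 n12 n23 s11 s12 s13 s21 s22 s23 s1K s2K
  s1t s1q s2t s2q p1 p2 braid q12.
have b2 := braid_three_term2 n12 n13 n23 s11 s12 s13 s21 s22 s23 s1K s2K
  s1t s1q s2t s2q p1 p2 braid q23.
have b0 := braid_identity_term n12 n13 n23 s11 s12 s13 s21 s22 s23 s1K s2K
  s1t s1q s2t s2q p1 p2 braid q12 q23.
exact: And3 b1 b2 b0.
Qed.

(** The three variables are free, so identities in [K[n]] specialise to arbitrary points of any
    commutative [K]-algebra. *)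
Lemma evalE (S : comNzRingType) (h : {rmorphism K -> S}) (x y z : S) :
  exists F : {rmorphism {mpoly K[n]} -> S},
    [/\ F (xl K i) = x, F (xr K i) = y, F (xr K j) = z
      & forall a b a' b' U, F a = a' -> F b = b' ->
        F (ev a b U) = ev_pair h a' b' U].
Proof.
have [F [F1 F2 F3 FC]] := eval_three_variables h x y z neq12 neq13 neq23.
by exists F; split=> // a b _ _ U <- <-; exact: rmorph_ev_pair.
Qed.

Lemma three_term_T (S : comNzRingType) (h : {rmorphism K -> S}) (x y z : S) :
  three_term h T x y z.
Proof.
have [F [F1 F2 F3 FE]] := evalE h x y z; have [e _ _] := braid_consequences.
exact: (rmorph_three_term e (FE _ _ _ _ _ F1 F2) (FE _ _ _ _ _ F2 F3)
  (FE _ _ _ _ _ F1 F3) (FE _ _ _ _ _ F2 F1) (FE _ _ _ _ _ F2 F3)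
  (FE _ _ _ _ _ F1 F3) F1 F2 F3).
Qed.

Lemma three_term_swap_T (S : comNzRingType) (h : {rmorphism K -> S})
    (x y z : S) :
  three_term h (swap_vars T) x y z.
Proof.
(* The variables are sent to [z], [y], [x] because the second relation is the one for [swap_vars T]
   read backwards. *)
have [F [F1 F2 F3 FE]] := evalE h z y x; have [_ e _] := braid_consequences.
have {}e := rmorph_three_term e (FE _ _ _ _ _ F1 F2) (FE _ _ _ _ _ F2 F3)
  (FE _ _ _ _ _ F1 F2) (FE _ _ _ _ _ F1 F3) (FE _ _ _ _ _ F1 F3)
  (FE _ _ _ _ _ F3 F2) F1 F2 F3.
rewrite /three_term !ev_pair_swap_vars; apply: three_term_reverse e.
Qed.

Lemma bilinear_ad_bc (a b c d : K) :
  T = a *: ('X_0 * 'X_1) + b *: 'X_0 + c *: 'X_1 + d%:MP -> a * d - b * c = 0.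
Proof.
move=> TE; have [+ _ _] := braid_consequences.
rewrite /t TE !ev_pair_bilinear => /bilinear_defect/eqP.
rewrite -!mpolyCM -mpolyCB mulf_eq0 mpolyC_eq0 => /orP[/eqP //|].
rewrite !mulf_eq0 !subr_eq0 (negbTE (mpolyX_inj neq12)).
by rewrite (negbTE (mpolyX_inj neq13)) (negbTE (mpolyX_inj neq23)).
Qed.

Lemma quotient_const (W : {mpoly K[2]}) (a b c d : K) :
  T = a *: ('X_0 * 'X_1) + b *: 'X_0 + c *: 'X_1 + d%:MP ->
  ('X_0 - 'X_1) * W = P - swap_vars P -> swap_vars W = W ->
  exists w, W = w%:MP.
Proof.
move=> TE WE symW; have [_ _ e] := braid_consequences.
have [_ T_neq0] := nondegenerate.
pose F := W * ((b - c)%:MP - W).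
suff [w wE] : exists w, F = w%:MP by exact: mpoly_const_of_quadratic wE.
apply: mpoly_const_of_ev_pair => S h x y z.
have [G [G1 G2 G3 GE]] := evalE h x y z.
apply: etrans (esym (GE _ _ _ _ F G1 G2))
  (etrans (congr1 G _) (GE _ _ _ _ F G2 G3)).
have Q0E : Q0 = T - ('X_0 - 'X_1) * W by rewrite WE; ring.
have qE u v : q u v = t u v - (u - v) * ev u v W.
  rewrite /q Q0E [LHS]rmorphB; congr (_ - _).
  rewrite [LHS]rmorphM; congr (_ * _).
  by rewrite [LHS]rmorphB /= ev_pairX0 ev_pairX1.
(* Symmetry of [W] expresses [q u v] and [q v u] through the same value of [W], as
   [bilinear_quadratic] requires. *)
have qE' u v : q v u = t v u - (v - u) * ev u v W.
  by rewrite qE -{1}symW ev_pair_swap_vars.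
have tE u v : t u v = a%:MP * (u * v) + b%:MP * u + c%:MP * v + d%:MP.
  by rewrite /t TE ev_pair_bilinear.
have FE u v : ev u v F = ev u v W * (b%:MP - c%:MP - ev u v W).
  rewrite [LHS]rmorphM [X in _ * X]rmorphB; congr (_ * (_ - _)).
  exact: etrans (ev_pairC _ _ _ _) (mpolyCB _ _ _).
rewrite [LHS]FE [RHS]FE.
apply: (quadratic_eq _ _ e).
- exact: bilinear_quadratic (tE _ _) (tE _ _) (qE _ _) (qE' _ _).
- exact: bilinear_quadratic (tE _ _) (tE _ _) (qE _ _) (qE' _ _).
- exact: ev_pair_neq0.
- by rewrite subr_eq0; exact: mpolyX_inj.
- by rewrite subr_eq0; exact: mpolyX_inj.
Qed.

End Operators.

Theorem mainTheorem1 (K : fieldType) (n : nat) (hn : (3 <= n)%N)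
    (P Q : {mpoly K[2]})
    (hnd : pi_nondegenerate P Q)
    (hbraid : braid_relations (fun i : 'I_n.-1 => piop P Q i)) :
  exists a b c d e : K,
    [/\ ~ [/\ a = 0, b = 0, c = 0 & d = 0],
        a * d - b * c = 0
      & forall (i : 'I_n.-1) (f : {mpoly K[n]}),
          piop P Q i f =
            (b - c - e) *: ddiff i (xl K i * f)
            + (a *: (xl K i * xr K i) + (c + e) *: xl K i + c *: xr K i
               + d%:MP) * ddiff i f].
Proof.
have lt1n : (1 < n.-1)%N by rewrite -subn1 ltn_subRL.
(* The first two operators exist since [n >= 3]. Their braid relation fixes the constants for all
   indices, because [P] and [Q] are common to all operators. *)
pose i : 'I_n.-1 := Ordinal (ltnW lt1n); pose j : 'I_n.-1 := Ordinal lt1n.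
have ij : nat_of_ord j = i.+1 by [].
have braid := hbraid.2 i j ij.
have [_ T_neq0] := hnd.
have [a [b [c [d TE]]]] := three_term_bilinear T_neq0
  (three_term_T hnd ij braid) (three_term_swap_T hnd ij braid).
have [W [WE symW]] := symmetric_quotient P.
have [w wE] := quotient_const hnd ij braid TE WE symW.
(* This [e] makes [b - c - e = w] and [c + e = b - w], matching [piop_normal_form]. *)
exists a, b, c, d, (b - c - w); split.
- case=> a0 b0 c0 d0; case/eqP: T_neq0.
  by rewrite TE a0 b0 c0 d0 !scale0r !addr0.
- exact: (bilinear_ad_bc hnd ij braid TE).
- move=> k f; rewrite subKr.
  have -> : c + (b - c - w) = b - w by ring.
  apply: piop_normal_form TE _.
  by rewrite -wE WE; ring.
Qed.
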